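(* (Nonlinear ISS small-gain theorem in summation formulation.) Let $I$ be a nonempty countable index set, let $(X_i,\|\cdot\|_{X_i})$, $i\in I$, be normed spaces and let $\Sigma_i=(X_i,\mathrm{PC}_b(\mathbb{R}_+,X_{\neq i})\times\mathcal{U},\bar\phi_i)$, $i\in I$, be forward complete control systems. Assume that the interconnection $\Sigma=(X,\mathcal{U},\phi)$ of the systems $\Sigma_i$ is well-defined. Furthermore, assume: (i) Each system $\Sigma_i$ is ISS in summation formulation, with $\beta_i\in\mathcal{KL}$ and nonlinear gains $\gamma_{ij},\gamma_i\in\mathcal{K}\cup\{0\}$ ($j\in I$). (ii) There are $\beta_{\max}\in\mathcal{KL}$ and $\gamma_{\max}\in\mathcal{K}$ such that $\beta_i\le\beta_{\max}$ and $\gamma_i\le\gamma_{\max}$ pointwise for all $i\in I$. (iii) It holds that $\sup_{i\in I}\sum_{j\in I}\gamma_{ij}(r)<\infty$ for every $r>0$, and, with $\Gamma_\boxplus:\ell_\infty(I)^+\to\ell_\infty(I)^+$, $\Gamma_\boxplus(s):=(\sum_{j\in I}\gamma_{ij}(s_j))_{i\in I}$, the discrete-time system $w(k+1)\le\Gamma_\boxplus(w(k))+v(k)$, with $w(\cdot),v(\cdot)$ taking values in $\ell_\infty(I)^+$, has the MLIM property. Then $\Sigma$ is ISS.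
   Context: **Comparison functions.** $\mathcal{K}$: continuous strictly increasing $\gamma:\mathbb{R}_+\to\mathbb{R}_+$ with $\gamma(0)=0$. $\mathcal{K}_\infty$: unbounded functions in $\mathcal{K}$. $\mathcal{L}$: continuous strictly decreasing $\gamma:\mathbb{R}_+\to\mathbb{R}_+$ with $\gamma(t)\to0$ as $t\to\infty$. $\mathcal{KL}$: continuous $\beta:\mathbb{R}_+^2\to\mathbb{R}_+$ with $\beta(\cdot,t)\in\mathcal{K}$ for all $t\ge0$ and $\beta(r,\cdot)\in\mathcal{L}$ for all $r>0$. In $\mathcal{K}\cup\{0\}$, $0$ is the zero function. **Sequence spaces.** $\ell_\infty(I)$ is the Banach space of bounded functions $x:I\to\mathbb{R}$ with the sup-norm; $\ell_\infty(I)^+$ is the cone of its componentwise nonnegative elements; $\le$ is the componentwise order. For $w:J\to W$ bounded, $J\subset\mathbb{R}_+$ nonempty, $W$ normed, $\|w\|_J:=\sup_{s\in J}\|w(s)\|_W$. **MLIM property.** Let $(X,X^+)$ be an ordered Banach space and $A:X^+\to X^+$ an operator. The system $x(k+1)\le A(x(k))+u(k)$, $k\in\mathbb{Z}_+$, has the monotone limit (MLIM) property if there is $\xi\in\mathcal{K}_\infty$ such that for every $\varepsilon>0$, every constant input $u(\cdot)\equiv w\in X^+$ and every decreasing solution $x:\mathbb{Z}_+\to X^+$ (i.e. a map satisfying the inequality for all $k$, with $x(k+1)\le x(k)$ for all $k$) there is $N\in\mathbb{Z}_+$ (depending on $\varepsilon,u,x(\cdot)$) with $\|x(N)\|_X\le\varepsilon+\xi(\|w\|_X)$.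 Here it is used with $X=\ell_\infty(I)$, $X^+=\ell_\infty(I)^+$. **Control systems.** A control system is a triple $\Sigma=(X,\mathcal{U},\phi)$ with: a normed space $(X,\|\cdot\|_X)$ (state space); a vector space $U$ of input values and a normed space of inputs $(\mathcal{U},\|\cdot\|_{\mathcal{U}})$, $\mathcal{U}$ a linear subspace of $U^{\mathbb{R}_+}$ (all maps $\mathbb{R}_+\to U$), satisfying shift invariance (for all $u\in\mathcal{U}$, $\tau\ge0$: $u(\cdot+\tau)\in\mathcal{U}$ and $\|u\|_{\mathcal{U}}\ge\|u(\cdot+\tau)\|_{\mathcal{U}}$) and concatenation (for all $u_1,u_2\in\mathcal{U}$, $t>0$, the function equal to $u_1(\tau)$ for $\tau\in[0,t]$ and $u_2(\tau-t)$ for $\tau>t$ is in $\mathcal{U}$); a transition map $\phi:D_\phi\to X$, $D_\phi\subseteq\mathbb{R}_+\times X\times\mathcal{U}$, such that for all $(x,u)$ one has $D_\phi\cap(\mathbb{R}_+\times\{(x,u)\})=[0,t_m)\times\{(x,u)\}$ for some $t_m=t_m(x,u)\in(0,\infty]$. The following axioms are required: $\phi(0,x,u)=x$; causality (if $(t,x,u)\in D_\phi$ and $\tilde u\in\mathcal{U}$ agrees with $u$ on $[0,t]$, then $[0,t]\times\{(x,\tilde u)\}\subset D_\phi$ and $\phi(t,x,u)=\phi(t,x,\tilde u)$); continuity of $t\mapsto\phi(t,x,u)$ on $[0,t_m(x,u))$; cocycle property (if $[0,t+h]\times\{(x,u)\}\subset D_\phi$, $t,h\ge 0$, then $\phi(h,\phi(t,x,u),u(t+\cdot))=\phi(t+h,x,u)$).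 $\Sigma$ is forward complete if $D_\phi=\mathbb{R}_+\times X\times\mathcal{U}$. $\Sigma$ has the boundedness-implies-continuation (BIC) property if for each $(x,u)$ with $t_m(x,u)<\infty$ and each $M>0$ there is $t\in[0,t_m)$ with $\|\phi(t,x,u)\|_X>M$. **ISS.** $\Sigma$ is input-to-state stable (ISS) if there are $\beta\in\mathcal{KL}$, $\gamma\in\mathcal{K}\cup\{0\}$ with $\|\phi(t,x,u)\|_X\le\beta(\|x\|_X,t)+\gamma(\|u\|_{\mathcal{U}})$ for all $(t,x,u)\in D_\phi$. **Interconnections.** Given normed spaces $X_i$, $i\in I$, put $X:=\{(x_i)_{i\in I}\in\prod_i X_i:\sup_i\|x_i\|_{X_i}<\infty\}$ with $\|x\|_X:=\sup_i\|x_i\|_{X_i}$, and let $X_{\neq i}$ be the same construction for the index set $I\setminus\{i\}$. $\mathrm{PC}_b(\mathbb{R}_+,X_{\neq i})$ is the space of globally bounded piecewise continuous functions $w:\mathbb{R}_+\to X_{\neq i}$ with sup-norm $\|w\|_\infty$. $\mathcal{U}$ is a fixed normed space of inputs (satisfying shift invariance and concatenation), common to all subsystems, and $\mathrm{PC}_b(\mathbb{R}_+,X_{\neq i})\times\mathcal{U}$ has norm $\max\{\|w\|_\infty,\|u\|_{\mathcal{U}}\}$. Given control systems $\Sigma_i=(X_i,\mathrm{PC}_b(\mathbb{R}_+,X_{\neq i})\times\mathcal{U},\bar\phi_i)$, consider maps $\phi:D_\phi\to X$, $D_\phi\subset\mathbb{R}_+\times X\times\mathcal{U}$, such that (1) for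 each $(x,u)\in X\times\mathcal{U}$ there is $\varepsilon>0$ with $[0,\varepsilon]\times\{(x,u)\}\subset D_\phi$; (2) the components satisfy $\phi_i(t,x,u)=\bar\phi_i(t,x_i,(\phi_{\neq i},u))$ for all $(t,x,u)\in D_\phi$, $i\in I$, where $\phi_{\neq i}(\cdot)=(\phi_j(\cdot,x,u))_{j\in I\setminus\{i\}}$ (by causality only the values of $\phi_{\neq i}$ on $[0,t]$ matter, so it can be regarded as globally bounded); and $\phi$ is maximal, i.e. no proper extension of $\phi$ satisfies these properties. If the map $\phi$ with these properties is unique and $\Sigma=(X,\mathcal{U},\phi)$ is a control system satisfying the BIC property, then $\Sigma$ is called the (well-defined) interconnection of the $\Sigma_i$. **ISS of $\Sigma_i$ in summation formulation.** $\Sigma_i$ is forward complete and there are $\beta_i\in\mathcal{KL}$ and $\gamma_{ij},\gamma_i\in\mathcal{K}\cup\{0\}$ ($j\in I$) such that for all $x_i\in X_i$, $w_{\neq i}=(w_j)_{j\in I\setminus\{i\}}\in\mathrm{PC}_b(\mathbb{R}_+,X_{\neq i})$, $u\in\mathcal{U}$, $t\ge0$: $\|\bar\phi_i(t,x_i,(w_{\neq i},u))\|_{X_i}\le\beta_i(\|x_i\|_{X_i},t)+\sum_{j\in I}\gamma_{ij}(\|w_j\|_{[0,t]})+\gamma_i(\|u\|_{\mathcal{U}})$, where $\sum_{j\in I}\gamma_{ij}(r)<\infty$ for every $r\ge0$ and $\gamma_{ii}=0$ (so the term $j=i$ is $0$). *)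

(* Defs.v *)
From HB Require Import structures.
From mathcomp Require Import all_boot all_order all_algebra.
From mathcomp Require Import all_classical all_reals all_analysis.

Set Implicit Arguments.
Unset Strict Implicit.
Unset Printing Implicit Defensive.
Import Order.TTheory GRing.Theory Num.Theory.
Import numFieldNormedType.Exports.
Local Open Scope classical_set_scope.
Local Open Scope ring_scope.

(* Throughout, a function on R_+ is a function on R whose values at negative
   arguments are irrelevant. *)

Section ComparisonFunctions.
Context {R : realType}.
Implicit Types (g : R -> R) (b : R -> R -> R).

Definition classK g : Prop :=
  [/\ {within `[0, +oo[%classic, continuous g},
      (forall r s : R, 0 <= r -> r < s -> g r < g s) &
      g 0 = 0].

Definition classKinfty g : Prop :=
  classK g /\ forall M : R, exists2 r : R, 0 <= r & M < g r.

Definition classL g : Prop :=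
  [/\ {within `[0, +oo[%classic, continuous g},
      (forall t : R, 0 <= t -> 0 <= g t),
      (forall s t : R, 0 <= s -> s < t -> g t < g s) &
      g t @[t --> +oo] --> (0 : R)].

Definition classKL b : Prop :=
  [/\ {within `[0, +oo[ `*` `[0, +oo[, continuous (fun p : R * R => b p.1 p.2)},
      (forall t : R, 0 <= t -> classK (b ^~ t)) &
      (forall r : R, 0 < r -> classL (b r))].

Definition zero_gain g : Prop := forall r : R, 0 <= r -> g r = 0.

Definition classK0 g : Prop := classK g \/ zero_gain g.

End ComparisonFunctions.

Definition supnorm {R : realType} {W : normedModType R} (J : set R)
    (w : R -> W) : R :=
  sup [set `|w s| | s in J].

Section Linfty.
Context {R : realType} {I : Type} (X : I -> normedModType R).

Definition bounded_family (f : forall i, X i) : Prop :=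
  exists M : R, forall i, `|f i| <= M.

Record linfty := Linfty {
  linfty_fun :> forall i, X i;
  linfty_bounded : bounded_family linfty_fun }.

Lemma linftyP (x y : linfty) : (forall i, x i = y i) -> x = y.
Proof.
case: x y => [f hf] [g hg] /= fg.
have {}fg : f = g by apply: functional_extensionality_dep.
by subst g; congr Linfty; exact: Prop_irrelevance.
Qed.

HB.instance Definition _ := gen_eqMixin linfty.
HB.instance Definition _ := gen_choiceMixin linfty.

Fact bounded_family0 : bounded_family (fun i => 0).
Proof. by exists 0 => i; rewrite normr0. Qed.

Fact bounded_familyD (x y : linfty) : bounded_family (fun i => x i + y i).
Proof.
case: x y => [f [M hf]] [g [N hg]] /=; exists (M + N) => i.
by rewrite (le_trans (ler_normD _ _))// lerD.
Qed.

Fact bounded_familyN (x : linfty) : bounded_family (fun i => - x i).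
Proof. by case: x => f [M hf]; exists M => i; rewrite normrN. Qed.

Fact bounded_familyZ (a : R) (x : linfty) : bounded_family (fun i => a *: x i).
Proof.
case: x => f [M hf]; exists (`|a| * M) => i.
by rewrite normrZ ler_wpM2l ?normr_ge0 ?hf.
Qed.

Let add x y := Linfty (bounded_familyD x y).
Let opp x := Linfty (bounded_familyN x).
Let scale a x := Linfty (bounded_familyZ a x).

Let addA : associative add.
Proof. by move=> x y z; apply: linftyP => i /=; rewrite addrA. Qed.
Let addC : commutative add.
Proof. by move=> x y; apply: linftyP => i /=; rewrite addrC. Qed.
Let add0 : left_id (Linfty bounded_family0) add.
Proof. by move=> x; apply: linftyP => i /=; rewrite add0r. Qed.
Let addN : left_inverse (Linfty bounded_family0) opp add.
Proof. by move=> x; apply: linftyP => i /=; rewrite addNr. Qed.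

HB.instance Definition _ := GRing.isZmodule.Build linfty addA addC add0 addN.

Let scaleA (a b : R) (x : linfty) : scale a (scale b x) = scale (a * b) x.
Proof. by apply: linftyP => i /=; rewrite scalerA. Qed.
Let scale1 : left_id 1 scale.
Proof. by move=> x; apply: linftyP => i /=; rewrite scale1r. Qed.
Let scaleDr : right_distributive scale +%R.
Proof. by move=> a x y; apply: linftyP => i /=; rewrite scalerDr. Qed.
Let scaleDl (x : linfty) : {morph scale^~ x : a b / a + b}.
Proof. by move=> a b; apply: linftyP => i /=; rewrite scalerDl. Qed.

HB.instance Definition _ :=
  GRing.Zmodule_isLmodule.Build R linfty scaleA scale1 scaleDr scaleDl.

Definition linfty_norm (x : linfty) : R := sup (range (fun i => `|x i|)).

Lemma linfty_normle (x : linfty) i : `|x i| <= linfty_norm x.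
Proof.
apply: ub_le_sup; last by exists i.
by case: x => f [M hf] /=; exists M => _ [j _ <-].
Qed.

Lemma linfty_norm_le (x : linfty) (M : R) :
  0 <= M -> (forall i, `|x i| <= M) -> linfty_norm x <= M.
Proof.
move=> M0 hM; rewrite /linfty_norm.
have [->|/set0P S0] := eqVneq (range (fun i => `|x i|)) set0; first by rewrite sup0.
by apply: ge_sup => // _ [j _ <-].
Qed.

Lemma linfty_norm_ge0 (x : linfty) : 0 <= linfty_norm x.
Proof.
have [S0|/set0P[_ [i _ _]]] := eqVneq (range (fun i => `|x i|)) set0.
  by rewrite /linfty_norm S0 sup0.
exact: le_trans (linfty_normle x i).
Qed.

Let normD (x y : linfty) : linfty_norm (x + y) <= linfty_norm x + linfty_norm y.
Proof.
apply: linfty_norm_le => [|i]; first by rewrite addr_ge0 ?linfty_norm_ge0.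
by rewrite (le_trans (ler_normD _ _))// lerD ?linfty_normle.
Qed.

Let normZ (a : R) (x : linfty) : linfty_norm (a *: x) = `|a| * linfty_norm x.
Proof.
have le (b : R) (y : linfty) : linfty_norm (b *: y) <= `|b| * linfty_norm y.
  apply: linfty_norm_le => [|i]; first by rewrite mulr_ge0 ?linfty_norm_ge0.
  by rewrite /= normrZ ler_wpM2l ?linfty_normle.
apply/eqP; rewrite eq_le le /=.
have [->|a0] := eqVneq a 0; first by rewrite normr0 mul0r linfty_norm_ge0.
rewrite -ler_pdivlMl ?normr_gt0// -normfV.
by rewrite -[x in leLHS](scalerK a0) le.
Qed.

Let norm0 (x : linfty) : linfty_norm x = 0 -> x = 0.
Proof.
move=> x0; apply: linftyP => i /=; apply/eqP.
by rewrite -normr_le0 -x0 linfty_normle.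
Qed.

HB.instance Definition _ :=
  Lmodule_isNormed.Build R linfty normD normZ norm0.

(* The element with the given components, if these are bounded. *)
Definition linfty_of (f : forall i, X i) : linfty :=
  if pselect (bounded_family f) is left hf then Linfty hf else 0.

Lemma linfty_ofE (f : forall i, X i) : bounded_family f ->
  forall i, linfty_of f i = f i.
Proof. by rewrite /linfty_of; case: pselect. Qed.

End Linfty.

Section PiecewiseContinuous.
Context {R : realType} (W : normedModType R).

(* Finitely many discontinuities on each bounded interval, all of them of the
   first kind; nothing is imposed on the value at a discontinuity. *)
Definition piecewise_continuous (f : R -> W) : Prop :=
  [/\ forall T : R, exists s : seq R, forall t : R, 0 < t -> t <= T ->
        t \notin s -> {for t, continuous f},
      forall t : R, 0 <= t -> cvg (f x @[x --> t^'+]) &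
      forall t : R, 0 < t -> cvg (f x @[x --> t^'-])].

(* The maps R_+ -> W are represented by their extensions by zero to R, so that
   Leibniz equality is equality on R_+. *)
Record PCb_of := PCb {
  PCb_fun :> R -> W;
  PCb_neg : forall t : R, t < 0 -> PCb_fun t = 0;
  PCb_pc : piecewise_continuous PCb_fun;
  PCb_bounded : exists M : R, forall t : R, 0 <= t -> `|PCb_fun t| <= M }.

Lemma PCbP (f g : PCb_of) : (forall t, 0 <= t -> f t = g t) -> f = g.
Proof.
case: f g => [f f0 fc fb] [g g0 gc gb] /= fg.
have {}fg : f = g.
  by apply/funext => t; have [/fg//|t0] := lerP 0 t; rewrite f0 ?g0.
by subst g; congr PCb; exact: Prop_irrelevance.
Qed.

HB.instance Definition _ := gen_eqMixin PCb_of.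
HB.instance Definition _ := gen_choiceMixin PCb_of.

Fact pc0 : piecewise_continuous (fun=> 0).
Proof.
split=> [T|t _|t _]; [|exact: is_cvg_cst|exact: is_cvg_cst].
by exists [::] => t _ _ _; exact: cvg_cst.
Qed.

Fact pcD (f g : R -> W) : piecewise_continuous f -> piecewise_continuous g ->
  piecewise_continuous (fun t => f t + g t).
Proof.
move=> [fc fr fl] [gc gr gl]; split=> [T|t t0|t t0].
- have [s hs] := fc T; have [s' hs'] := gc T.
  exists (s ++ s') => t t0 tT; rewrite mem_cat negb_or => /andP[ts ts'].
  by apply: cvgD; [exact: hs|exact: hs'].
- by apply: is_cvgD; [exact: fr|exact: gr].
- by apply: is_cvgD; [exact: fl|exact: gl].
Qed.

Fact pcZ (a : R) (f : R -> W) : piecewise_continuous f ->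
  piecewise_continuous (fun t => a *: f t).
Proof.
move=> [fc fr fl]; split=> [T|t t0|t t0].
- have [s hs] := fc T; exists s => t t0 tT ts.
  by apply: cvgZr; exact: hs.
- by apply: is_cvgZr; exact: fr.
- by apply: is_cvgZr; exact: fl.
Qed.

Definition PCb0 : PCb_of.
Proof.
by refine (@PCb (fun=> 0) _ pc0 _) => //; exists 0 => t _; rewrite normr0.
Defined.

Definition PCb_add (f g : PCb_of) : PCb_of.
Proof.
refine (@PCb (fun t => f t + g t) _ (pcD (PCb_pc f) (PCb_pc g)) _).
  by move=> t t0; rewrite !PCb_neg ?addr0.
have [M hM] := PCb_bounded f; have [N hN] := PCb_bounded g.
exists (M + N) => t t0; rewrite (le_trans (ler_normD _ _))//.
by rewrite lerD ?hM ?hN.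
Defined.

Definition PCb_scale (a : R) (f : PCb_of) : PCb_of.
Proof.
refine (@PCb (fun t => a *: f t) _ (pcZ a (PCb_pc f)) _).
  by move=> t t0; rewrite PCb_neg ?scaler0.
have [M hM] := PCb_bounded f.
by exists (`|a| * M) => t t0; rewrite normrZ ler_wpM2l ?normr_ge0 ?hM.
Defined.

Let addA : associative PCb_add.
Proof. by move=> x y z; apply: PCbP => t _ /=; rewrite addrA. Qed.
Let addC : commutative PCb_add.
Proof. by move=> x y; apply: PCbP => t _ /=; rewrite addrC. Qed.
Let add0 : left_id PCb0 PCb_add.
Proof. by move=> x; apply: PCbP => t _ /=; rewrite add0r. Qed.
Let addN : left_inverse PCb0 (PCb_scale (-1)) PCb_add.
Proof. by move=> x; apply: PCbP => t _ /=; rewrite scaleN1r addNr. Qed.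

HB.instance Definition _ := GRing.isZmodule.Build PCb_of addA addC add0 addN.

Let scaleA (a b : R) (x : PCb_of) :
  PCb_scale a (PCb_scale b x) = PCb_scale (a * b) x.
Proof. by apply: PCbP => t _ /=; rewrite scalerA. Qed.
Let scale1 : left_id 1 PCb_scale.
Proof. by move=> x; apply: PCbP => t _ /=; rewrite scale1r. Qed.
Let scaleDr : right_distributive PCb_scale +%R.
Proof. by move=> a x y; apply: PCbP => t _ /=; rewrite scalerDr. Qed.
Let scaleDl (x : PCb_of) : {morph PCb_scale^~ x : a b / a + b}.
Proof. by move=> a b; apply: PCbP => t _ /=; rewrite scalerDl. Qed.

HB.instance Definition _ :=
  GRing.Zmodule_isLmodule.Build R PCb_of scaleA scale1 scaleDr scaleDl.

Definition PCb_norm (f : PCb_of) : R := supnorm `[0, +oo[ f.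

Lemma PCb_normle (f : PCb_of) t : 0 <= t -> `|f t| <= PCb_norm f.
Proof.
move=> t0; apply: ub_le_sup; last first.
  by exists t => //=; rewrite in_itv /= t0.
have [M hM] := PCb_bounded f; exists M => _ [s /= + <-].
by rewrite in_itv /= andbT => /hM.
Qed.

Lemma PCb_norm_le (f : PCb_of) (M : R) :
  (forall t, 0 <= t -> `|f t| <= M) -> PCb_norm f <= M.
Proof.
move=> hM; apply: ge_sup.
  by exists `|f 0|, 0 => //=; rewrite in_itv /= lexx.
by move=> _ [s /= + <-]; rewrite in_itv /= andbT => /hM.
Qed.

Let normD (f g : PCb_of) : PCb_norm (f + g) <= PCb_norm f + PCb_norm g.
Proof.
apply: PCb_norm_le => t t0.
by rewrite (le_trans (ler_normD _ _))// lerD ?PCb_normle.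
Qed.

Let normZ (a : R) (f : PCb_of) : PCb_norm (a *: f) = `|a| * PCb_norm f.
Proof.
have le (b : R) (y : PCb_of) : PCb_norm (b *: y) <= `|b| * PCb_norm y.
  by apply: PCb_norm_le => t t0; rewrite /= normrZ ler_wpM2l ?PCb_normle.
apply/eqP; rewrite eq_le le /=.
have [->|a0] := eqVneq a 0.
  by rewrite normr0 mul0r (le_trans _ (PCb_normle _ (lexx 0))).
rewrite -ler_pdivlMl ?normr_gt0// -normfV.
by rewrite -[f in leLHS](scalerK a0) le.
Qed.

Let norm0 (f : PCb_of) : PCb_norm f = 0 -> f = 0.
Proof.
move=> f0; apply: PCbP => t t0 /=; apply/eqP.
by rewrite -normr_le0 -f0 PCb_normle.
Qed.

HB.instance Definition _ :=
  Lmodule_isNormed.Build R PCb_of normD normZ norm0.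

End PiecewiseContinuous.

Section PCbClosure.
Context {R : realType} {W : normedModType R}.
Implicit Types f g : R -> W.

Let cvg_shift (t c : R) : x + c @[x --> t] --> t + c.
Proof. by apply: cvgD; [exact: cvg_id|exact: cvg_cst]. Qed.

Let cvg_shift_right (t c : R) : x + c @[x --> t^'+] --> (t + c)^'+.
Proof.
move=> A /= [e e0 eA]; exists e => // x xe tx.
by apply: eA; rewrite ?ltrD2r//= opprD addrACA subrr addr0.
Qed.

Let cvg_shift_left (t c : R) : x + c @[x --> t^'-] --> (t + c)^'-.
Proof.
move=> A /= [e e0 eA]; exists e => // x xe tx.
by apply: eA; rewrite ?ltrD2r//= opprD addrACA subrr addr0.
Qed.

Let cvg_congr (F : set_system R) {FF : Filter F} f g :
  (\forall x \near F, f x = g x) -> cvg (f x @[x --> F]) ->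
  cvg (g x @[x --> F]).
Proof.
by move=> fg /cvg_ex[l fl]; apply/cvg_ex; exists l; apply: cvg_trans fl; exact: near_eq_cvg.
Qed.

Let cvg_pt_congr f g (t : R) : (\forall x \near t, f x = g x) ->
  {for t, continuous f} -> {for t, continuous g}.
Proof.
move=> fg ft; rewrite /prop_for /continuous_at -(nbhs_singleton fg).
by apply: cvg_trans ft; exact: near_eq_cvg.
Qed.

Fact pc_shift f (c : R) : 0 <= c -> piecewise_continuous f ->
  piecewise_continuous (fun t => if t < 0 then 0 else f (t + c)).
Proof.
move=> c0 [fc fr fl]; split=> [T|t t0|t t0].
- have [s hs] := fc (T + c); exists (map (fun x => x - c) s) => t t0 tT ts.
  apply: (@cvg_pt_congr (fun x => f (x + c))).
    near=> x; rewrite ltNge ifF//; apply/negbTE; rewrite negbK.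
    by near: x; exact: lt_le_nbhsr.
  suff ft : {for t + c, continuous f}.
    exact: (@cvg_comp _ _ _ (fun x => x + c) f _ _ _ (@cvg_shift t c) ft).
  apply: hs; rewrite ?lerD2r ?ltr_wpDr//.
  by apply: contra ts => ts; apply/mapP; exists (t + c); rewrite ?addrK.
- apply: (@cvg_congr _ _ (fun x => f (x + c))).
    near=> x; rewrite ltNge ifF//; apply/negbTE; rewrite negbK.
    by rewrite (le_trans t0)// ltW.
  have /cvg_ex[l hl] := fr _ (addr_ge0 t0 c0).
  by apply/cvg_ex; exists l; exact: (@cvg_comp _ _ _ (fun x => x + c) f _ _ _ (@cvg_shift_right t c) hl).
- apply: (@cvg_congr _ _ (fun x => f (x + c))).
    near=> x; rewrite ltNge ifF//; apply/negbTE; rewrite negbK.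
    by near: x; exact: nbhs_left_ge.
  have /cvg_ex[l hl] := fl _ (ltr_wpDr c0 t0).
  by apply/cvg_ex; exists l; exact: (@cvg_comp _ _ _ (fun x => x + c) f _ _ _ (@cvg_shift_left t c) hl).
Unshelve. all: by end_near. Qed.

Fact pc_concat f g (c : R) : 0 < c -> piecewise_continuous f ->
  piecewise_continuous g ->
  piecewise_continuous (fun t => if t <= c then f t else g (t - c)).
Proof.
move=> c0 [fc fr fl] [gc gr gl]; split=> [T|t t0|t t0].
- have [s hs] := fc T; have [s' hs'] := gc T.
  exists (c :: s ++ map (fun x => x + c) s') => t t0 tT.
  rewrite inE mem_cat !negb_or => /and3P[tc ts ts'].
  have [ltc|gtc|/eqP] := ltgtP t c; last by rewrite (negPf tc).
    apply: (@cvg_pt_congr f); last exact: hs.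
    near=> x; rewrite ifT//; near: x; exact: lt_le_nbhsl.
  apply: (@cvg_pt_congr (fun x => g (x - c))).
    near=> x; rewrite ifF//; apply/negbTE; rewrite -ltNge.
    by near: x; exact: lt_nbhsr.
  suff gt : {for t - c, continuous g}.
    exact: (@cvg_comp _ _ _ (fun x => x - c) g _ _ _ (@cvg_shift t (- c)) gt).
  apply: hs'; rewrite ?subr_gt0// ?(le_trans _ tT) ?gerBl ?ltW//.
  by apply: contra ts' => ts'; apply/mapP; exists (t - c); rewrite ?subrK.
- have [tc|ct] := ltP t c.
    apply: (@cvg_congr _ _ f); last exact: fr.
    near=> x; rewrite ifT//; near: x; exact: nbhs_right_le.
  apply: (@cvg_congr _ _ (fun x => g (x - c))).
    near=> x; rewrite ifF//; apply/negbTE; rewrite -ltNge.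
    by rewrite (le_lt_trans ct).
  have tc0 : 0 <= t - c by rewrite subr_ge0.
  have /cvg_ex[l hl] := gr _ tc0.
  by apply/cvg_ex; exists l; exact: (@cvg_comp _ _ _ (fun x => x - c) g _ _ _ (@cvg_shift_right t (- c)) hl).
- have [tc|ct] := leP t c.
    apply: (@cvg_congr _ _ f); last exact: fl.
    near=> x; rewrite ifT// (le_trans _ tc)// ltW//.
  apply: (@cvg_congr _ _ (fun x => g (x - c))).
    near=> x; rewrite ifF//; apply/negbTE; rewrite -ltNge.
    by near: x; exact: nbhs_left_gt.
  have tc0 : 0 < t - c by rewrite subr_gt0.
  have /cvg_ex[l hl] := gl _ tc0.
  by apply/cvg_ex; exists l; exact: (@cvg_comp _ _ _ (fun x => x - c) g _ _ _ (@cvg_shift_left t (- c)) hl).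
Unshelve. all: by end_near. Qed.

Lemma PCb_shift_invariance (f : PCb_of W) (c : R) : 0 <= c ->
  exists2 g : PCb_of W, forall t, 0 <= t -> g t = f (t + c) & `|g| <= `|f|.
Proof.
move=> c0.
have gE t : 0 <= t -> (if t < 0 then 0 else f (t + c)) = f (t + c).
  by move=> t0; rewrite ltNge t0.
have g0 t : t < 0 -> (if t < 0 then 0 else f (t + c)) = 0 by move=> ->.
have gb : exists M : R, forall t, 0 <= t ->
    `|if t < 0 then 0 else f (t + c)| <= M.
  have [M hM] := PCb_bounded f; exists M => t t0.
  by rewrite gE// hM// addr_ge0.
exists (PCb g0 (pc_shift c0 (PCb_pc f)) gb); first exact: gE.
by apply: PCb_norm_le => t t0 /=; rewrite gE// PCb_normle// addr_ge0.
Qed.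

Lemma PCb_concatenation (f g : PCb_of W) (c : R) : 0 < c ->
  exists h : PCb_of W,
    (forall s, 0 <= s -> s <= c -> h s = f s) /\
    (forall s, c < s -> h s = g (s - c)).
Proof.
move=> c0.
have h0 t : t < 0 -> (if t <= c then f t else g (t - c)) = 0.
  by move=> t0; rewrite ifT ?PCb_neg// (le_trans (ltW t0))// ltW.
have hb : exists M : R, forall t, 0 <= t ->
    `|if t <= c then f t else g (t - c)| <= M.
  have [M hM] := PCb_bounded f; have [N hN] := PCb_bounded g.
  exists (Num.max M N) => t t0; rewrite le_max.
  have [tc|ct] := leP t c; first by rewrite hM.
  by rewrite hN ?orbT// subr_ge0 ltW.
exists (PCb h0 (pc_concat c0 (PCb_pc f) (PCb_pc g)) hb).
by split=> [s _ sc|s cs] /=; [rewrite sc|rewrite leNgt cs].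
Qed.

End PCbClosure.

Section InputSpaces.
Context {R : realType}.

(* A normed space of maps R_+ -> input_value, linear and faithful evaluation
   [input_at u t] standing for u(t), t >= 0. *)
Record input_space := InputSpace {
  input_value : lmodType R;
  input_carrier :> normedModType R;
  input_at : input_carrier -> R -> input_value;
  input_at_linear : forall (a : R) (u v : input_carrier) (t : R), 0 <= t ->
    input_at (a *: u + v) t = a *: input_at u t + input_at v t;
  input_at_inj : forall u v : input_carrier,
    (forall t : R, 0 <= t -> input_at u t = input_at v t) -> u = v;
  input_shift_invariance : forall (u : input_carrier) (tau : R), 0 <= tau ->
    exists2 v : input_carrier,
      forall t : R, 0 <= t -> input_at v t = input_at u (t + tau) & `|v| <= `|u|;
  input_concatenation : forall (u1 u2 : input_carrier) (t : R), 0 < t ->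
    exists v : input_carrier,
      (forall s : R, 0 <= s -> s <= t -> input_at v s = input_at u1 s) /\
      (forall s : R, t < s -> input_at v s = input_at u2 (s - t)) }.

Definition is_shift (U : input_space) (u : U) (tau : R) (v : U) : Prop :=
  forall t : R, 0 <= t -> input_at v t = input_at u (t + tau).

Definition agree_upto (U : input_space) (t : R) (u v : U) : Prop :=
  forall s : R, 0 <= s -> s <= t -> input_at u s = input_at v s.

End InputSpaces.
Arguments input_space R : clear implicits.


Section CouplingInputs.
Context {R : realType} (W : normedModType R) (U : input_space R).

Definition coupling_at (wu : (PCb_of W * U)%type) (t : R) : (W * input_value U)%type :=
  (wu.1 t, input_at wu.2 t).

Fact coupling_at_linear (a : R) (u v : (PCb_of W * U)%type) (t : R) : 0 <= t ->
  coupling_at (a *: u + v) t = a *: coupling_at u t + coupling_at v t.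
Proof. by move=> t0; rewrite /coupling_at /= input_at_linear. Qed.

Fact coupling_at_inj (u v : (PCb_of W * U)%type) :
  (forall t, 0 <= t -> coupling_at u t = coupling_at v t) -> u = v.
Proof.
case: u v => [u1 u2] [v1 v2] uv; congr pair.
  by apply: PCbP => t /uv[].
by apply: input_at_inj => t /uv[].
Qed.

Fact coupling_at_shift (u : (PCb_of W * U)%type) (tau : R) : 0 <= tau ->
  exists2 v : (PCb_of W * U)%type,
    forall t, 0 <= t -> coupling_at v t = coupling_at u (t + tau) & `|v| <= `|u|.
Proof.
case: u => u1 u2 tau0.
have [v1 v1E v1u] := PCb_shift_invariance u1 tau0.
have [v2 v2E v2u] := input_shift_invariance u2 tau0.
exists (v1, v2) => [t t0|]; first by rewrite /coupling_at /= v1E ?v2E.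
by rewrite !prod_normE /= ge_max !le_max v1u v2u orbT.
Qed.

Fact coupling_at_concat (u1 u2 : (PCb_of W * U)%type) (t : R) : 0 < t ->
  exists v : (PCb_of W * U)%type,
    (forall s, 0 <= s -> s <= t -> coupling_at v s = coupling_at u1 s) /\
    (forall s, t < s -> coupling_at v s = coupling_at u2 (s - t)).
Proof.
case: u1 u2 => [u1 u1'] [u2 u2'] t0.
have [v [v1 v2]] := PCb_concatenation u1 u2 t0.
have [v' [v1' v2']] := input_concatenation u1' u2' t0.
exists (v, v'); split=> s; rewrite /coupling_at /=.
  by move=> s0 st; rewrite v1 ?v1'.
by move=> ts; rewrite v2 ?v2'.
Qed.

(* PC_b(R_+, W) x U; the norm of the library on the product is the maximum of
   the two norms. *)
Definition coupling_inputs : input_space R :=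
  InputSpace coupling_at_linear coupling_at_inj coupling_at_shift
    coupling_at_concat.

End CouplingInputs.

Section ControlSystems.
Context {R : realType}.

(* The domain of the transition map is
   { (t, x, u) | 0 <= t < tmax x u }; [flow] is irrelevant outside of it. *)
Record control_system (X : normedModType R) (U : input_space R) :=
  ControlSystem {
  tmax : X -> U -> \bar R;
  flow : R -> X -> U -> X;
  in_dom := fun (t : R) (x : X) (u : U) => 0 <= t /\ (t%:E < tmax x u)%E;
  tmax_gt0 : forall x u, (0 < tmax x u)%E;
  flow0 : forall x u, flow 0 x u = x;
  flow_causal : forall (t : R) (x : X) (u v : U), in_dom t x u ->
    agree_upto t u v -> in_dom t x v /\ flow t x u = flow t x v;
  flow_continuous : forall x u,
    {within [set t | in_dom t x u], continuous (fun t => flow t x u)};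
  flow_cocycle : forall (t h : R) (x : X) (u v : U), 0 <= t -> 0 <= h ->
    in_dom (t + h) x u -> is_shift u t v ->
    in_dom h (flow t x u) v /\ flow h (flow t x u) v = flow (t + h) x u }.

Definition forward_complete X U (S : control_system X U) : Prop :=
  forall (t : R) (x : X) (u : U), 0 <= t -> in_dom S t x u.

Definition BIC X U (S : control_system X U) : Prop :=
  forall (x : X) (u : U), (tmax S x u < +oo)%E ->
  forall M : R, 0 < M -> exists2 t : R, in_dom S t x u & M < `|flow S t x u|.

Definition ISS X U (S : control_system X U) : Prop :=
  exists (beta : R -> R -> R) (gamma : R -> R),
    [/\ classKL beta, classK0 gamma &
     forall (t : R) (x : X) (u : U), in_dom S t x u ->
       `|flow S t x u| <= beta `|x| t + gamma `|u| ].

End ControlSystems.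

Section Interconnection.
Context {R : realType} {I : countType} (X : I -> normedModType R).
Context (U : input_space R).

Definition product_space_ne (i : I) : normedModType R :=
  linfty (fun j : {j : I | j != i} => X (val j)).

Definition subsystem (i : I) : Type :=
  control_system (X i) (coupling_inputs (product_space_ne i) U).

Context (S : forall i, subsystem i).

(* A candidate transition map: a domain together with the values on it. *)
Definition partial_flow : Type :=
  (set (R * linfty X * U) * (R -> linfty X -> U -> linfty X))%type.

Implicit Types p q : partial_flow.

(* For (t, x, u) in the domain, the map w is the restriction of s |->
   (phi_j(s, x, u))_{j != i} to [0, t], extended to R_+ in an arbitrary way;
   by causality the extension does not matter. *)
Definition coupled_flow p : Prop :=
  [/\ forall t x u, p.1 (t, x, u) -> 0 <= t,
      forall x u, exists2 eps : R, 0 < eps &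
        forall t : R, 0 <= t -> t <= eps -> p.1 (t, x, u) &
      forall t x u, p.1 (t, x, u) ->
        (forall s : R, 0 <= s -> s <= t -> p.1 (s, x, u)) /\
        forall i, exists w : PCb_of (product_space_ne i),
          [/\ forall s : R, 0 <= s -> s <= t ->
                forall j, w s j = p.2 s x u (val j),
              in_dom (S i) t (x i) (w, u) &
              p.2 t x u i = flow (S i) t (x i) (w, u)]].

Definition extends q p : Prop :=
  forall t x u, p.1 (t, x, u) -> q.1 (t, x, u) /\ q.2 t x u = p.2 t x u.

Definition maximal_coupled_flow p : Prop :=
  coupled_flow p /\
  forall q, coupled_flow q -> extends q p -> extends p q.

Definition graph_of (T : control_system (linfty X) U) : partial_flow :=
  ([set txu | in_dom T txu.1.1 txu.1.2 txu.2], flow T).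

Definition is_interconnection (T : control_system (linfty X) U) : Prop :=
  [/\ maximal_coupled_flow (graph_of T),
      forall q, maximal_coupled_flow q ->
        extends q (graph_of T) /\ extends (graph_of T) q &
      BIC T].

End Interconnection.

Notation real_linfty R J :=
  (linfty (fun _ : J => R^o : normedModType R)).

Section Gains.
Context {R : realType} {I : countType}.

Definition ISS_summation (X : I -> normedModType R) (U : input_space R) (i : I)
    (S : subsystem X U i) (beta : R -> R -> R) (gain : I -> R -> R)
    (gainu : R -> R) : Prop :=
  [/\ forward_complete S, classKL beta,
      (forall j, classK0 (gain j)) /\ zero_gain (gain i) /\ classK0 gainu,
      forall r : R, 0 <= r ->
        (\esum_(j in [set: I]) (gain j r)%:E < +oo)%E &
      forall (t : R) (x : X i) (w : PCb_of (product_space_ne X i)) (u : U),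
        0 <= t ->
        ((`|flow S t x (w, u)|)%:E <=
         (beta `|x| t)%:E +
         \esum_(j in [set: {j : I | j != i}])
           (gain (val j) (supnorm `[0, t] (fun s => w s j)))%:E +
         (gainu `|u|)%:E)%E].

Definition linfty_pos (J : Type) : set (real_linfty R J) :=
  [set s | forall i, 0 <= s i].

(* The operator Gamma_boxplus; under the uniform bound on the row sums of the
   gains it has the displayed components on the positive cone ([gain_opE]), and
   [linfty_of] only makes it total. *)
Definition gain_op (gain : I -> I -> R -> R) (s : real_linfty R I) :
    real_linfty R I :=
  linfty_of (fun i =>
    fine (\esum_(j in [set: I]) (gain i j (s j))%:E)%E : R^o).

Lemma classK0_ge0 (g : R -> R) (r : R) : classK0 g -> 0 <= r -> 0 <= g r.
Proof.
move=> [[_ g_lt g0]|g0] r_ge0; last by rewrite g0.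
move: r_ge0; rewrite le_eqVlt => /predU1P[<-|r0].
  by rewrite g0.
by rewrite -g0 ltW// g_lt.
Qed.

Lemma classK0_le (g : R -> R) (r s : R) : classK0 g -> 0 <= r -> r <= s ->
  g r <= g s.
Proof.
move=> [[_ g_lt g0]|g0] r0; last by move=> rs; rewrite !g0// (le_trans r0).
by rewrite le_eqVlt => /predU1P[->//|rs]; rewrite ltW// g_lt.
Qed.

Lemma gain_opE (gain : I -> I -> R -> R) (s : real_linfty R I) :
  (forall i j, classK0 (gain i j)) ->
  (forall r : R, 0 < r ->
    (ereal_sup (range (fun i =>
       \esum_(j in [set: I]) (gain i j r)%:E)) < +oo)%E) ->
  linfty_pos s ->
  linfty_pos (gain_op gain s) /\
  forall i,
    ((gain_op gain s i)%:E = \esum_(j in [set: I]) (gain i j (s j))%:E)%E.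
Proof.
move=> gK gsup s0.
have r0 : 0 < `|s| + 1 by rewrite ltr_wpDl.
have esum0 i (f : I -> R) : (forall j, 0 <= f j) ->
    (0 <= \esum_(j in [set: I]) (gain i j (f j))%:E)%E.
  by move=> f0; apply: esum_ge0 => j _; rewrite lee_fin classK0_ge0.
have lesup i : (\esum_(j in [set: I]) (gain i j (s j))%:E <=
    ereal_sup (range (fun i => \esum_(j in [set: I])
      (gain i j (`|s| + 1))%:E)))%E.
  apply: (@le_trans _ _ (\esum_(j in [set: I]) (gain i j (`|s| + 1))%:E)%E).
    apply: le_esum => j _; rewrite lee_fin classK0_le ?s0//.
    rewrite -[leLHS]ger0_norm ?s0//.
    by rewrite (le_trans (linfty_normle s j))// lerDl.
  by apply: ereal_sup_ubound; exists i.
have fin i : (\esum_(j in [set: I]) (gain i j (s j))%:E)%E \is a fin_num.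
  rewrite ge0_fin_numE ?(le_lt_trans (lesup i)) ?gsup//.
  exact: esum0.
have bnd : bounded_family (fun i =>
    fine (\esum_(j in [set: I]) (gain i j (s j))%:E)%E : R^o).
  exists (fine (ereal_sup (range (fun i => \esum_(j in [set: I])
      (gain i j (`|s| + 1))%:E))))%E => i.
  rewrite ger0_norm ?fine_ge0 ?esum0// fine_le//.
  rewrite ge0_fin_numE ?gsup//.
  exact: le_trans (esum0 i _ s0) (lesup i).
by split=> i; rewrite /gain_op linfty_ofE// ?fine_ge0 ?esum0// fineK.
Qed.

End Gains.

(* [Xpos] is the positive cone of the ordered space [X], i.e.
   x <= y stands for y - x \in Xpos. *)
Definition MLIM {R : realType} (X : normedModType R) (Xpos : set X)
    (A : X -> X) : Prop :=
  exists2 xi : R -> R, classKinfty xi &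
    forall (eps : R) (w : X) (x : nat -> X), 0 < eps -> Xpos w ->
      (forall k, Xpos (x k)) ->
      (forall k, Xpos (A (x k) + w - x k.+1)) ->
      (forall k, Xpos (x k - x k.+1)) ->
      exists N, `|x N| <= eps + xi `|w|.

(* Main.v *)
(* Since a constant sequence [z] with [z <= Gamma z + w] is a decreasing
   solution, MLIM gives [`|z| <= xi `|w|] for such [z]. Applied to the
   vector of the suprema of the components of a trajectory over [[0, t]],
   this bounds the trajectories uniformly, and BIC yields forward
   completeness. For a fixed step [t1] making [beta_max] small, the suprema
   over all times [>= n t1] and over bounded sets of initial states and
   inputs form another decreasing solution; MLIM then gives a uniform
   asymptotic gain. Finally, a family of trajectories with a uniform bound
   and a uniform decay is dominated by a KL function, obtained by
   sup-convolution with Lipschitz ramps. *)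
Require Import Defs.
From mathcomp Require Import all_boot all_order all_algebra.
From mathcomp Require Import all_classical all_reals all_analysis.
From mathcomp Require Import lra.

Set Implicit Arguments.
Unset Strict Implicit.
Unset Printing Implicit Defensive.
Import Order.TTheory GRing.Theory Num.Theory.
Import numFieldNormedType.Exports.
Local Open Scope classical_set_scope.
Local Open Scope ring_scope.

(** * Comparison functions *)

Section ComparisonFunctions.
Context {R : realType}.
Implicit Types f g : R -> R.

Lemma within_continuous_comp (T1 T2 T3 : topologicalType) (A : set T1)
    (B : set T2) (f : T1 -> T2) (g : T2 -> T3) :
  (forall x, A x -> B (f x)) ->
  {within A, continuous f} -> {within B, continuous g} ->
  {within A, continuous (g \o f)}.
Proof.
move=> AB /subspace_continuousP fc /subspace_continuousP gc.
apply: (subspace_continuousP A (g \o f)).2 => x Ax V.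
move=> /(gc _ (AB _ Ax)) /(fc _ Ax).
rewrite /= !nbhs_simpl/= /within/=; apply: filterS => y /= VBy Ay.
exact: VBy (AB _ Ay).
Qed.

Lemma classK_ge0 f (r : R) : classK f -> 0 <= r -> 0 <= f r.
Proof. by move=> fK; apply: classK0_ge0; left. Qed.

Lemma classK_le f (r s : R) : classK f -> 0 <= r -> r <= s -> f r <= f s.
Proof. by move=> fK; apply: classK0_le; left. Qed.

(** Weak triangle inequality: [r + s] is at most twice the larger of the two, and the value of [f]
    at twice the smaller is nonnegative. *)
Lemma classK_add_le f (r s : R) : classK f -> 0 <= r -> 0 <= s ->
  f (r + s) <= f (r + r) + f (s + s).
Proof.
move=> fK r0 s0; have [rs|/ltW sr] := leP r s.
  by rewrite ler_wpDl ?(classK_ge0 fK) ?addr_ge0// (classK_le fK)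
    ?addr_ge0 ?lerD.
by rewrite ler_wpDr ?(classK_ge0 fK) ?addr_ge0// (classK_le fK) ?addr_ge0 ?lerD.
Qed.

Lemma classK_comp f g : classK f -> classK g -> classK (f \o g).
Proof.
move=> fK gK; have [fc fi f0] := fK; have [gc gi g0] := gK; split=> /=.
- apply: within_continuous_comp gc fc => x /=.
  by rewrite !in_itv/= !andbT; exact: classK_ge0.
- by move=> r s r0 rs; rewrite fi ?classK_ge0 ?gi.
- by rewrite g0.
Qed.

Lemma classKD f g : classK f -> classK g -> classK (fun r => f r + g r).
Proof.
move=> [fc fi f0] [gc gi g0]; split.
- by move=> x; apply: continuousD; [exact: fc|exact: gc].
- by move=> r s r0 rs; rewrite ltrD ?fi ?gi.
- by rewrite f0 g0 addr0.
Qed.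

Lemma classK_id : classK (@id R).
Proof. by split => //; apply: continuous_subspaceT => x; exact: cvg_id. Qed.

Lemma classK_small f (eps : R) : classK f -> 0 < eps ->
  exists2 d : R, 0 < d & f d <= eps.
Proof.
move=> fK eps0; have [/subspace_continuousP fc _ f0] := fK.
have /fc/cvgrPdist_le/(_ _ eps0) : `[0, +oo[%classic (0 : R).
  by rewrite /= in_itv/= lexx.
rewrite /prop_near1/= /within/= => /nbhs_ballP[d d0 dE].
have d2 : 0 < d / 2 by exact: divr_gt0.
exists (d / 2) => //.
have d2b : ball 0 d (d / 2).
  by rewrite /ball/= sub0r normrN gtr0_norm// ltr_pdivrMr// ltr_pMr// ltr1n.
have : `|f 0 - f (d / 2)| <= eps by apply: dE; rewrite //= in_itv/= ltW.
by rewrite f0 sub0r normrN; apply: le_trans; exact: ler_norm.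
Qed.

Lemma classKL_small (b : R -> R -> R) (r eps : R) : classKL b -> 0 <= r ->
  0 < eps -> exists2 t : R, 0 <= t & b r t <= eps.
Proof.
move=> [_ bK bL]; rewrite le_eqVlt => /predU1P[<- eps0|r0 eps0].
  (* Class L is available only for positive [r]; at [r = 0] the value is [0] by class K, so any time
     will do. *)
  by exists 0 => //; have [_ _ ->] := bK 0 (lexx 0); exact: ltW.
have [_ _ _ /cvgrPdist_le/(_ _ eps0)[M [_ hM]]] := bL _ r0.
exists (Num.max 0 (M + 1)); first by rewrite le_max lexx.
rewrite (le_trans (ler_norm _))// -normrN -sub0r hM//.
by rewrite lt_max ltrDl ltr01 orbT.
Qed.

Lemma classKL_le_l (b : R -> R -> R) (r s t : R) : classKL b -> 0 <= r ->
  r <= s -> 0 <= t -> b r t <= b s t.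
Proof. by move=> [_ bK _] r0 rs t0; exact: (classK_le (bK _ t0)). Qed.

Lemma classKL_le_r (b : R -> R -> R) (r s t : R) : classKL b -> 0 <= r ->
  0 <= s -> s <= t -> b r t <= b r s.
Proof.
move=> [_ bK bL]; rewrite le_eqVlt => /predU1P[<- s0 st|r0 s0].
  by have [_ _ ->] := bK _ s0; have [_ _ ->] := bK _ (le_trans s0 st).
rewrite le_eqVlt => /predU1P[->//|st].
by have [_ _ b_lt _] := bL _ r0; rewrite ltW ?b_lt.
Qed.

End ComparisonFunctions.

(** * A KL majorant for a uniformly bounded and uniformly decaying family *)

Section KLMajorant.
Context {R : realType}.

(** A 1-Lipschitz substitute for a step function: sharp cutoffs could make the supremum [F] below
    discontinuous. *)
Definition ramp (x : R) : R := Num.max 0 (Num.min 1 x).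

Lemma ramp_ge0 x : 0 <= ramp x.
Proof. by rewrite le_max lexx. Qed.

Lemma ramp_le1 x : ramp x <= 1.
Proof. by rewrite ge_max ler01 ge_min lexx. Qed.

Lemma ramp0 x : x <= 0 -> ramp x = 0.
Proof. by move=> x0; apply/max_idPl; rewrite ge_min x0 orbT. Qed.

Lemma ramp1 x : 1 <= x -> ramp x = 1.
Proof. by move=> x1; rewrite /ramp (min_idPl x1); apply/max_idPr. Qed.

Lemma ramp_le x y : x <= y -> ramp x <= ramp y.
Proof.
by move=> xy; rewrite ge_max !le_max lexx/= le_min !ge_min lexx xy !orbT.
Qed.

Lemma ramp_lip x y : ramp x <= ramp y + `|x - y|.
Proof.
have := ler_norm (x - y); have := normr_ge0 (x - y) => ? ?.
rewrite /ramp; case: (leP 1 x); case: (leP 1 y) => ? ?;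
  case: (leP 0 x) => ?; case: (leP 0 y) => ?; rewrite ?(max_idPr ler01); lra.
Qed.

Context (E : Type) (D rho tau : E -> R) (sigma : R -> R) (e0 : E).
Hypotheses (sigmaK : classK sigma) (D_ge0 : forall e, 0 <= D e)
  (rho_ge0 : forall e, 0 <= rho e)
  (D_le : forall e, D e <= sigma (rho e))
  (D_decay : forall r eps : R, 0 <= r -> 0 < eps -> exists T : R,
     forall e, rho e <= r -> T <= tau e -> D e <= eps).

(** The weight of [D e] is [1] when [rho e <= r] and [t <= tau e], and [0] as soon as
    [rho e >= r + 1] or [tau e <= t - 1]. Thus [F] is a regularised supremum of [D] over
    [rho e <= r], [tau e >= t]. *)
Let term r t e := D e * ramp (1 + r - rho e) * ramp (1 + tau e - t).
Let F r t := sup (range (term r t)).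

Let term_ge0 r t e : 0 <= term r t e.
Proof. by rewrite !mulr_ge0 ?ramp_ge0. Qed.

Let term_le_D r t e : term r t e <= D e.
Proof. by rewrite /term -mulrA ler_piMr// mulr_ile1 ?ramp_ge0 ?ramp_le1. Qed.

(** If one of the two conditions on [e] fails, the corresponding ramp vanishes and [0 <= M]
    suffices. *)
Let term_le (M r t : R) e : 0 <= M ->
  (rho e <= 1 + r -> t - 1 <= tau e -> D e <= M) -> term r t e <= M.
Proof.
move=> M0 DM; have [re|re] := leP (rho e) (1 + r); last first.
  by rewrite /term (@ramp0 (1 + r - rho e)) ?mulr0 ?mul0r//; lra.
have [te|te] := leP (t - 1) (tau e); last first.
  by rewrite /term (@ramp0 (1 + tau e - t)) ?mulr0//; lra.
exact: le_trans (term_le_D _ _ _) (DM re te).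
Qed.

Let term_le_sigma (r t : R) e : 0 <= r -> term r t e <= sigma (1 + r).
Proof.
move=> r0; have r1 : 0 <= 1 + r by rewrite addr_ge0.
apply: term_le => [|re _]; rewrite ?(classK_ge0 sigmaK)//.
exact: le_trans (D_le e) (classK_le sigmaK _ _).
Qed.

(** If [rho e > 1 + r] the left term is [0]; otherwise [D e <= sigma (1 + M)]. The difference of the
    products of ramps has the form [a b - a' b' = (a - a') b + a' (b - b')] with [a'] and [b] in
    [[0, 1]], and each ramp is 1-Lipschitz. *)
Let term_lip (M r s t t' : R) e : 0 <= r -> r <= M ->
  term r t e <= term s t' e + sigma (1 + M) * (`|r - s| + `|t - t'|).
Proof.
move=> r0 rM; set C := sigma _.
have C0 : 0 <= C by rewrite (classK_ge0 sigmaK)//; lra.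
have Cn0 : 0 <= C * (`|r - s| + `|t - t'|) by rewrite mulr_ge0 ?addr_ge0.
have [re|re] := leP (rho e) (1 + r); last first.
  by rewrite {1}/term (@ramp0 (1 + r - rho e)) ?mulr0 ?mul0r ?addr_ge0//; lra.
have DC : D e <= C.
  by rewrite (le_trans (D_le e))// (classK_le sigmaK)//; lra.
rewrite -lerBlDl /term -!mulrA -mulrBr.
apply: (@le_trans _ _ (D e * (`|r - s| + `|t - t'|))); last first.
  by rewrite ler_wpM2r ?addr_ge0.
rewrite ler_wpM2l//.
have := ramp_lip (1 + r - rho e) (1 + s - rho e).
have := ramp_lip (1 + tau e - t) (1 + tau e - t').
rewrite (_ : 1 + r - rho e - _ = r - s); last by lra.
rewrite (_ : 1 + tau e - t - _ = - (t - t')) ?normrN; last by lra.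
have := ramp_ge0 (1 + s - rho e); have := ramp_le1 (1 + s - rho e).
have := ramp_ge0 (1 + tau e - t); have := ramp_le1 (1 + tau e - t).
have := normr_ge0 (r - s); have := normr_ge0 (t - t').
move: (ramp _) (ramp _) (ramp _) (ramp _) `|_| `|_| => a b c d p q *.
nra.
Qed.

Let F_ub (r t : R) e : 0 <= r -> term r t e <= F r t.
Proof.
move=> r0; apply: ub_le_sup; last by exists e.
by exists (sigma (1 + r)) => _ [e' _ <-]; exact: term_le_sigma.
Qed.

Let F_le (r t M : R) : (forall e, term r t e <= M) -> F r t <= M.
Proof.
by move=> h; apply: ge_sup; [exists (term r t e0), e0|move=> _ [e _ <-]].
Qed.

Let F_ge0 (r t : R) : 0 <= r -> 0 <= F r t.
Proof. by move=> r0; exact: le_trans (term_ge0 r t e0) (F_ub _ _ _). Qed.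

Let F_lip (M r s t t' : R) : 0 <= r -> r <= M -> 0 <= s -> s <= M ->
  `|F r t - F s t'| <= sigma (1 + M) * (`|r - s| + `|t - t'|).
Proof.
move=> r0 rM s0 sM.
have le (r1 s1 t1 t1' : R) : 0 <= r1 -> r1 <= M -> 0 <= s1 ->
    F r1 t1 - F s1 t1' <= sigma (1 + M) * (`|r1 - s1| + `|t1 - t1'|).
  move=> ? ? ?; rewrite lerBlDl; apply: F_le => e.
  by rewrite (le_trans (@term_lip M _ s1 _ t1' e _ _))// lerD2r F_ub.
by rewrite ler_norml lerNl opprB le// andbT distrC (distrC t) le.
Qed.

Let F_homo (r s t : R) : 0 <= r -> r <= s -> F r t <= F s t.
Proof.
move=> r0 rs; apply: F_le => e.
apply: le_trans (F_ub t e (le_trans r0 rs)).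
by rewrite /term ler_wpM2r ?ramp_ge0// ler_wpM2l// ramp_le//; lra.
Qed.

Let F_anti (r s t : R) : 0 <= r -> s <= t -> F r t <= F r s.
Proof.
move=> r0 st; apply: F_le => e; apply: le_trans (F_ub s e r0).
by rewrite /term ler_wpM2l ?mulr_ge0 ?ramp_ge0// ramp_le//; lra.
Qed.

(** For [t >= T + 1], with [T] the decay time for the radius [1 + r], every [e] of positive weight
    has [tau e >= T], hence [D e <= eps]. *)
Let F_cvg0 (r : R) : 0 <= r -> F r t @[t --> +oo] --> (0 : R).
Proof.
move=> r0; apply/cvgrPdist_le => eps eps_gt0.
have r1 : 0 <= 1 + r by rewrite addr_ge0.
have [T hT] := D_decay r1 eps_gt0.
near=> t; rewrite sub0r normrN ger0_norm ?F_ge0//.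
apply: F_le => e; apply: term_le => [|re te]; first exact: ltW.
rewrite hT// (le_trans _ te)// lerBrDr.
by near: t; apply: nbhs_pinfty_ge; exact: num_real.
Unshelve. all: by end_near. Qed.

Let F_continuous :
  {within `[0, +oo[ `*` `[0, +oo[, continuous (fun p : R * R => F p.1 p.2)}.
Proof.
apply: (subspace_continuousP _ _).2 => -[r t] [/=].
rewrite !in_itv/= !andbT => r0 t0; apply/cvgrPdist_le => eps eps_gt0.
(* [C] is the Lipschitz constant of [F] for first arguments in [[0, r + 1]], which contains every
   admissible [s] since [d <= 1]; [C + 1] keeps the denominator of [d] positive. *)
set C := sigma (1 + (r + 1)).
have C0 : 0 <= C by rewrite (classK_ge0 sigmaK)//; lra.
set d := Num.min 1 (eps / (2 * (C + 1))).
have C1 : 0 < C + 1 by lra.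
have d0 : 0 < d by rewrite lt_min ltr01/= divr_gt0 ?mulr_gt0.
apply/nbhs_ballP; exists d => //= -[s t'] [/= rs tt'] []/=.
rewrite !in_itv/= !andbT => s0 t'0.
move: rs tt'; rewrite /ball/= => /ltW rs /ltW tt'.
have d1 : d <= 1 by rewrite ge_min lexx.
have sr : s <= r + 1 by move: rs; rewrite ler_norml; lra.
apply: le_trans (F_lip _ _ r0 _ s0 sr) _; first by lra.
apply: (@le_trans _ _ (C * (d + d))); first by rewrite ler_wpM2l// lerD.
have dE : d <= eps / (2 * (C + 1)) by rewrite ge_min lexx orbT.
apply: (@le_trans _ _ ((C + 1) * (d + d))).
  by rewrite ler_wpM2r; lra.
by move: dE; rewrite ler_pdivlMr ?mulr_gt0//; lra.
Qed.

(* The term [r * expR (- t)] makes the monotonicity of the other summand strict;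
   the minimum with [sigma] forces the value [0] at [r = 0]. *)
Let b r t := Num.min (sigma r) (F r t) + r * expR (- t).

Lemma classKL_majorant : exists2 beta : R -> R -> R, classKL beta &
  forall e, D e <= beta (rho e) (tau e).
Proof.
have [sc si s0] := sigmaK.
have bc : {within `[0, +oo[ `*` `[0, +oo[,
    continuous (fun p : R * R => b p.1 p.2)}.
  rewrite /b => p; apply: cvgD.
    apply: (min_fun_continuous (f := fun p : subspace _ => sigma p.1)) p;
      last exact: F_continuous.
    apply: (within_continuous_comp _ _ sc) => [p [] //|].
    by apply: continuous_subspaceT => p; exact: cvg_fst.
  apply: cvgM; move: p; apply: continuous_subspaceT => p.
    exact: cvg_fst.
  apply: (@continuous_comp _ _ _ (fun p : R * R => - p.2) expR).
    by apply: cvgN; exact: cvg_snd.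
  exact: continuous_expR.
exists b; last first.
  move=> e; apply: ler_wpDr; first by rewrite mulr_ge0 ?expR_ge0.
  rewrite le_min D_le/=; apply: le_trans (F_ub _ e _) => //.
  (* At [(rho e, tau e)] both ramps equal [1], so [D e] is one of the values whose supremum is
     [F]. *)
  by rewrite /term !ramp1 ?mulr1//; lra.
split=> //.
- move=> t t0; split.
  + apply: (within_continuous_comp _ _ bc (f := fun r => (r, t))).
      by move=> r; split=> //=; rewrite in_itv/= t0.
    apply: continuous_subspaceT => r.
    by apply: (cvg_pair (G := nbhs r) (H := nbhs t));
      [exact: cvg_id|exact: cvg_cst].
  + move=> r s r0 rs; rewrite /b ler_ltD ?ltr_pM2r ?expR_gt0//.
    by rewrite le_min !ge_min (classK_le sigmaK r0 (ltW rs)) F_homo ?orbT// ltW.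
  + by rewrite /b s0 mul0r addr0; apply/min_idPl; exact: F_ge0.
- move=> r r0; have r0' := ltW r0; split.
  + apply: (within_continuous_comp _ _ bc (f := fun t => (r, t))).
      by move=> t; split=> //=; rewrite in_itv/= r0'.
    apply: continuous_subspaceT => t.
    by apply: (cvg_pair (G := nbhs r) (H := nbhs t));
      [exact: cvg_cst|exact: cvg_id].
  + move=> t t0; rewrite addr_ge0 ?mulr_ge0 ?expR_ge0//.
    by rewrite le_min F_ge0// (classK_ge0 sigmaK).
  + move=> s t s_ge0 st; rewrite /b ler_ltD// ?ltr_pM2l ?ltr_expR ?ltrN2//.
    by rewrite le_min !ge_min lexx/= F_anti ?orbT// ltW.
  + rewrite -[0]addr0; apply: cvgD.
      apply: (@squeeze_cvgr _ _ _ _ (cst 0) (F r)); last 2 first.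
      * exact: cvg_cst.
      * exact: F_cvg0.
      near=> t; rewrite le_min F_ge0// (classK_ge0 sigmaK)//=.
      by rewrite ge_min lexx orbT.
    rewrite -[0](mulr0 r); apply: cvgMr; exact: cvgr_expR.
Unshelve. all: by end_near. Qed.

End KLMajorant.

(** * Componentwise suprema in the space of bounded families, and sums over subtypes *)

Lemma linfty_norm_comp (R : realType) (I : Type) (X : I -> normedModType R)
  (x : linfty X) i : `|x i| <= `|x|.
Proof. exact: linfty_normle. Qed.

Lemma linfty_norm_ub (R : realType) (I : Type) (X : I -> normedModType R)
    (x : linfty X) (M : R) :
  0 <= M -> (forall i, `|x i| <= M) -> `|x| <= M.
Proof. exact: linfty_norm_le. Qed.

Section LinftySup.
Context {R : realType} {I : Type} {X : I -> normedModType R}.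

Fact bounded_family_cst (c : R) : bounded_family (fun _ : I => c : R^o).
Proof. by exists `|c|. Qed.

Definition linfty_cst (c : R) : real_linfty R I :=
  Linfty (bounded_family_cst c).

(** Only an inequality, because the norm is [0] over an empty index type. *)
Lemma linfty_cst_norm (c : R) : 0 <= c -> `|linfty_cst c| <= c.
Proof. by move=> c0; apply: linfty_norm_le => // i /=; rewrite ger0_norm. Qed.

Context {K : Type} (f : K -> linfty X).
Implicit Type P : set K.

(** This turns a set of states into a vector to which the gain operator applies. [linfty_of] makes
    it total; the components are the intended ones when [f] is bounded on [P] ([linfty_supE]). *)
Definition linfty_sup P : real_linfty R I :=
  linfty_of (fun i => sup [set `|f k i| | k in P] : R^o).

Let bounded_on P := exists M : R, forall k, P k -> `|f k| <= M.

Let sup_ub P i k : bounded_on P -> P k ->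
  `|f k i| <= sup [set `|f k i| | k in P].
Proof.
move=> [M hM] Pk; apply: ub_le_sup; last by exists k.
by exists M => _ [l Pl <-]; exact: le_trans (linfty_norm_comp _ _) (hM _ Pl).
Qed.

Let sup_le P i (c : R) : 0 <= c -> (forall k, P k -> `|f k i| <= c) ->
  sup [set `|f k i| | k in P] <= c.
Proof.
move=> c0 fc.
have [->|/set0P[_ [k Pk _]]] := eqVneq [set `|f k i| | k in P] set0.
  by rewrite sup0.
by apply: ge_sup => [|_ [l Pl <-]]; [exists `|f k i|, k|exact: fc].
Qed.

Let sup_ge0 P i : bounded_on P -> 0 <= sup [set `|f k i| | k in P].
Proof.
move=> Pb; have [->|/set0P[_ [k Pk _]]] := eqVneq [set `|f k i| | k in P] set0.
  by rewrite sup0.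
exact: le_trans (sup_ub i Pb Pk).
Qed.

Lemma linfty_supE P i : bounded_on P ->
  linfty_sup P i = sup [set `|f k i| | k in P].
Proof.
move=> Pb; rewrite linfty_ofE//; have [M hM] := Pb.
exists (Num.max 0 M) => j; rewrite ger0_norm ?sup_ge0//.
apply: sup_le => [|k Pk]; first by rewrite le_max lexx.
by rewrite le_max (le_trans (linfty_norm_comp _ _) (hM _ Pk)) orbT.
Qed.

Lemma linfty_sup_pos P : bounded_on P -> linfty_pos (linfty_sup P).
Proof. by move=> Pb i; rewrite linfty_supE// sup_ge0. Qed.

Lemma linfty_sup_ub P i k : bounded_on P -> P k -> `|f k i| <= linfty_sup P i.
Proof. by move=> Pb Pk; rewrite linfty_supE// sup_ub. Qed.

Lemma linfty_sup_le P i (c : R) : bounded_on P -> 0 <= c ->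
  (forall k, P k -> `|f k i| <= c) -> linfty_sup P i <= c.
Proof. by move=> Pb c0 fc; rewrite linfty_supE// sup_le. Qed.

Lemma linfty_sup_norm P k : bounded_on P -> P k -> `|f k| <= `|linfty_sup P|.
Proof.
move=> Pb Pk; apply: linfty_norm_ub => // i.
apply: le_trans (linfty_sup_ub i Pb Pk) _.
exact: le_trans (ler_norm _) (linfty_norm_comp (linfty_sup P) i).
Qed.

End LinftySup.

(** Bridges the sum over [j != i] in the subsystem estimate and the full row sum in [gain_op]:
    reindex along the injection [val], then add nonnegative terms. *)
Lemma esum_val_le (R : realType) (I : countType) (P : pred I)
    (a : I -> \bar R) : (forall j, 0 <= a j)%E ->
  (\esum_(j in [set: {j : I | P j}]) a (val j) <= \esum_(j in [set: I]) a j)%E.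
Proof.
move=> a0; rewrite -(esum_image setT val a); last exact: (in2W val_inj).
by rewrite esum_mkcond; apply: le_esum => j _; case: ifP.
Qed.

(** * The small-gain argument *)

Section SmallGain.
Context {R : realType} {I : countType} {X : I -> normedModType R}.
Context {U : input_space R} {S : forall i : I, subsystem X U i}.
Context {T : control_system (linfty X) U}.
Context {beta : I -> R -> R -> R} {gain : I -> I -> R -> R}.
Context {gainu : I -> R -> R} {bmax : R -> R -> R} {gmax : R -> R}.
Hypotheses (TS : is_interconnection S T)
  (S_ISS : forall i, ISS_summation (S i) (beta i) (gain i) (gainu i))
  (bmaxKL : classKL bmax) (gmaxK : classK gmax)
  (beta_le : forall i (r t : R), 0 <= r -> 0 <= t -> beta i r t <= bmax r t)
  (gainu_le : forall i (r : R), 0 <= r -> gainu i r <= gmax r)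
  (gain_sup : forall r : R, 0 < r ->
    (ereal_sup (range (fun i =>
       \esum_(j in [set: I]) (gain i j r)%:E)) < +oo)%E).

(** The coupling presents component [i] as a trajectory of [S i] whose input [w] agrees on [[0, t]]
    with the other components. Monotone gains let [z] replace their suprema in the ISS estimate. *)
Lemma flow_estimate (t : R) (x : linfty X) (u : U) (z : real_linfty R I) :
  in_dom T t x u -> linfty_pos z ->
  (forall (s : R) j, 0 <= s -> s <= t -> `|flow T s x u j| <= z j) ->
  forall i, `|flow T t x u i| <= bmax `|x| t + gain_op gain z i + gmax `|u|.
Proof.
move=> dom z0 zub i; have t0 : 0 <= t by case: dom.
have gK i' j : classK0 (gain i' j) by have [_ _ []] := S_ISS i'.
have [_ /(_ i) Gz] := gain_opE gK gain_sup z0.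
have [[[_ _ cf] _] _ _] := TS.
have [_ /(_ i)[w [wE _ flE]]] := cf t x u dom.
have [_ betaKL _ _ iss] := S_ISS i.
have {iss} := iss t (x i) w u t0; rewrite -flE => h.
rewrite -lee_fin; apply: le_trans h _; rewrite !EFinD Gz.
rewrite !leeD//.
- rewrite lee_fin; apply: le_trans (beta_le i _ t0) _ => //.
  by apply: classKL_le_l => //; exact: linfty_norm_comp.
- apply: (@le_trans _ _
    (\esum_(j in [set: {j : I | j != i}]) (gain i (val j) (z (val j)))%:E)%E).
    apply: le_esum => j _; rewrite lee_fin.
    have wz s : `[0, t]%classic s -> `|w s j| <= z (val j).
      by rewrite /= in_itv/= => /andP[s0 st]; rewrite wE// zub.
    (* Gains are monotone only on nonnegative arguments; the time [0] shows that the supremum of [w]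
       is nonnegative and taken over a nonempty set. *)
    have t00 : `[0, t]%classic (0 : R) by rewrite /= in_itv/= lexx.
    apply: classK0_le => //; last first.
      by apply: ge_sup => [|_ [s st <-]]; [exists `|w 0 j|, 0|exact: wz].
    apply: (@le_trans _ _ `|w 0 j|) => //; apply: ub_le_sup; last by exists 0.
    by exists (z (val j)) => _ [s st <-]; exact: wz.
  apply: (@esum_val_le _ _ _ (fun j => (gain i j (z j))%:E)) => j.
  by rewrite lee_fin classK0_ge0.
- by rewrite lee_fin gainu_le.
Qed.

(** * Consequences of MLIM: a global bound and forward completeness *)

Context {xi : R -> R}.
Hypotheses (xiK : classK xi)
  (mlim : forall (eps : R) (w : real_linfty R I) (x : nat -> real_linfty R I),
    0 < eps -> linfty_pos w -> (forall k, linfty_pos (x k)) ->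
    (forall k, linfty_pos (gain_op gain (x k) + w - x k.+1)) ->
    (forall k, linfty_pos (x k - x k.+1)) ->
    exists N, `|x N| <= eps + xi `|w|).

Let flow_bounded (t : R) (x : linfty X) (u : U) : in_dom T t x u ->
  exists M : R, forall s : R, `[0, t]%classic s -> `|flow T s x u| <= M.
Proof.
move=> [t0 tm].
have /compact_bounded[M [_ hM]] :
    compact ((fun s => flow T s x u) @` `[0, t]%classic).
  apply: continuous_compact (@segment_compact _ _ _).
  apply: continuous_subspaceW (@flow_continuous _ _ _ T x u) => s.
  by rewrite /= in_itv/= => /andP[s0 st]; split=> //; exact: le_lt_trans tm.
by exists (M + 1) => s st; apply: hM; [rewrite ltrDl|exists s].
Qed.

Let zero_le_bmax (r t : R) : 0 <= r -> 0 <= t -> 0 <= bmax r t.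
Proof. by case: bmaxKL => _ bK _ r0 t0; exact: (classK_ge0 (bK t t0)). Qed.

(* A point [z <= gain_op gain z + w] is a constant solution, so that the MLIM
   property bounds its norm. *)
Lemma flow_bound (t : R) (x : linfty X) (u : U) : in_dom T t x u ->
  `|flow T t x u| <= xi (bmax `|x| 0 + gmax `|u|).
Proof.
move=> dom; have [t0 tm] := dom; set c := bmax _ _ + _.
have g0 : 0 <= gmax `|u| by rewrite (classK_ge0 gmaxK).
have c0 : 0 <= c by rewrite addr_ge0 ?zero_le_bmax.
have Pb := flow_bounded dom.
set z := linfty_sup (fun s => flow T s x u) `[0, t]%classic.
have z0 : linfty_pos z := linfty_sup_pos Pb.
have gK i' j : classK0 (gain i' j) by have [_ _ []] := S_ISS i'.
have [Gz0 _] := gain_opE gK gain_sup z0.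
have zle i : z i <= gain_op gain z i + c.
  apply: linfty_sup_le => // [|s]; first by rewrite addr_ge0.
  rewrite /= in_itv/= => /andP[s0 st].
  have ds : in_dom T s x u by split=> //; exact: le_lt_trans tm.
  apply: le_trans (flow_estimate ds z0 _ i) _.
    move=> s' j s'0 s's; apply: (linfty_sup_ub j Pb).
    by rewrite /= in_itv/= s'0 (le_trans s's).
  by rewrite addrAC addrC lerD2l lerD2r classKL_le_r.
apply: (@le_trans _ _ `|z|).
  by apply: (linfty_sup_norm Pb); rewrite /= in_itv/= t0 lexx.
(* MLIM gives the bound up to [eps] at some index only; the sequence is constant, so the index is
   immaterial and [eps] is arbitrary. *)
apply/ler_addgt0Pl => eps eps0.
have [_ zN] := mlim (w := linfty_cst c) (x := fun=> z) eps0 (fun=> c0)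
  (fun=> z0) (fun _ i => ltac:(by rewrite subr_ge0; exact: zle))
  (fun _ i => ltac:(by rewrite subrr)).
by rewrite (le_trans zN)// lerD2l (classK_le xiK)// linfty_cst_norm.
Qed.

Lemma flow_forward_complete : forward_complete T.
Proof.
move=> t x u t0; split=> //.
have [fin|] := ltP (tmax T x u) +oo%E; last first.
  by rewrite leye_eq => /eqP->; rewrite ltry.
have [_ _ /(_ x u fin)] := TS; set M := xi (bmax `|x| 0 + gmax `|u|).
(* [BIC] asks for a positive threshold; [|M| + 1] is one, and it is still at least [M]. *)
have M0 : 0 < `|M| + 1 by rewrite ltr_wpDl.
case/(_ _ M0) => s ds; rewrite ltNge (le_trans (flow_bound ds))//.
by rewrite (le_trans (ler_norm _))// lerDl.
Qed.

(** * Asymptotic gain and ISS *)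

Let dbl (f : R -> R) (r : R) : R := f r + f r.

Let dblK f : classK f -> classK (dbl f).
Proof. by move=> fK; exact: classKD. Qed.

(* The suprema of the trajectories over [s >= n t1], [`|x| <= r], [`|u| <= q],
   taken componentwise, form a decreasing solution. *)
Lemma flow_asymptotic_gain (r q eps : R) : 0 <= r -> 0 <= q -> 0 < eps ->
  exists t1 : R, forall (t : R) (x : linfty X) (u : U),
    0 <= t -> t1 <= t -> `|x| <= r -> `|u| <= q ->
    `|flow T t x u| <= eps + xi (dbl gmax q).
Proof.
move=> r0 q0 eps0; have e2 : 0 < eps / 2 by rewrite divr_gt0.
have g0 : 0 <= gmax q by rewrite (classK_ge0 gmaxK).
set M := xi (bmax r 0 + gmax q).
have M0 : 0 <= M by rewrite (classK_ge0 xiK)// addr_ge0 ?zero_le_bmax.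
have Mub t x u : 0 <= t -> `|x| <= r -> `|u| <= q -> `|flow T t x u| <= M.
  move=> t0 xr uq.
  apply: le_trans (flow_bound (flow_forward_complete x u t0)) _.
  rewrite (classK_le xiK)//.
    by rewrite addr_ge0 ?zero_le_bmax ?(classK_ge0 gmaxK).
  by rewrite lerD ?(classK_le gmaxK)// classKL_le_l.
(* [d] makes [xi (d + d) <= eps / 2], the share of [eps] left when [xi (d + gmax q)] is split at the
   end; after time [t1] the transient from any state of norm at most [M] is below [d]. *)
have [d d0 hd] := classK_small (classK_comp xiK (dblK classK_id)) e2.
have [t1 t10 ht1] := classKL_small bmaxKL M0 d0.
pose f (k : R * linfty X * U) := flow T k.1.1 k.1.2 k.2.
pose P (n : nat) (k : R * linfty X * U) :=
  [/\ n%:R * t1 <= k.1.1, `|k.1.2| <= r & `|k.2| <= q].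
have nt0 (n : nat) : 0 <= n%:R * t1 by rewrite mulr_ge0.
have Pb n : exists M : R, forall k, P n k -> `|f k| <= M.
  by exists M => k [tk xk uk]; rewrite Mub// (le_trans (nt0 n)).
have gK i j : classK0 (gain i j) by have [_ _ []] := S_ISS i.
pose w n := linfty_sup f (P n).
have w0 n : linfty_pos (w n) := linfty_sup_pos (Pb n).
have dg0 : 0 <= d + gmax q by rewrite addr_ge0// ltW.
have Ptail n : P n.+1 `<=` P n.
  move=> k [tk xk uk]; split=> //; apply: le_trans tk.
  by rewrite ler_wpM2r// ler_nat.
have w_dec n i : w n.+1 i <= w n i.
  apply: linfty_sup_le => // [|k /Ptail]; first exact: w0.
  exact: linfty_sup_ub.
have w_sol n i : w n.+1 i <= gain_op gain (w n) i + (d + gmax q).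
  have [Gw0 _] := gain_opE gK gain_sup (w0 n).
  apply: linfty_sup_le => // [|[[s x] u] [/= ts xr uq]].
    by rewrite addr_ge0.
  rewrite /f/=; set tau := n%:R * t1.
  have st1 : t1 <= s - tau.
    by rewrite lerBrDr (le_trans _ ts)// -natr1 mulrDl mul1r addrC.
  have st0 : 0 <= s - tau := le_trans t10 st1.
  (* Restart at [tau = n t1]: the new initial state has norm at most [M], the shifted input is no
     larger, at least [t1] has elapsed, and the restarted trajectory only visits states indexed by
     [P n]. *)
  have [v uv vu] := input_shift_invariance u (nt0 n).
  have cocycle h : 0 <= h ->
      flow T h (flow T tau x u) v = flow T (tau + h) x u.
    move=> h0; have th0 : 0 <= tau + h by rewrite addr_ge0 ?nt0.
    by have [] := flow_cocycle (nt0 n) h0 (flow_forward_complete x u th0) uv.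
  have dom := flow_forward_complete (flow T tau x u) v st0.
  rewrite -[s in flow T s](subrKC tau) -cocycle//.
  apply: le_trans (flow_estimate dom (w0 n) _ i) _.
    move=> s' j s'0 _; rewrite cocycle//.
    apply: (linfty_sup_ub (f := f) (k := (tau + s', x, u)) j (Pb n)).
    by split=> //=; rewrite lerDl.
  rewrite addrAC addrC lerD2l lerD//.
    apply: le_trans ht1; apply: (@le_trans _ _ (bmax M (s - tau))).
      by rewrite classKL_le_l// Mub ?nt0.
    exact: classKL_le_r.
  by rewrite (classK_le gmaxK)// (le_trans vu).
have [N wN] := mlim (w := linfty_cst (d + gmax q)) (x := w) e2 (fun=> dg0) w0
  (fun n i => ltac:(by rewrite subr_ge0; exact: w_sol))
  (fun n i => ltac:(by rewrite subr_ge0; exact: w_dec)).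
exists (N%:R * t1) => t x u t0 Nt xr uq.
have Pk : P N (t, x, u) by [].
apply: le_trans (linfty_sup_norm (Pb N) Pk) _; apply: le_trans wN _.
rewrite [eps in leRHS]splitr -addrA lerD2l.
apply: (@le_trans _ _ (xi (d + gmax q))).
  by rewrite (classK_le xiK)// linfty_cst_norm.
by apply: le_trans (classK_add_le xiK (ltW d0) g0) _; rewrite lerD2r.
Qed.

(** The part due to the initial state when [classK_add_le] splits the bound of [flow_bound]. *)
Let sigma : R -> R := xi \o dbl (bmax^~ 0).
(** The summand [sigma s] absorbs initial states with [|x| <= |u|]; the argument [s + s] absorbs the
    passage from [q] to [2 q]. *)
Let gamma (s : R) : R := sigma s + xi (dbl gmax (s + s)).

Let sigmaK : classK sigma.
Proof.
by apply: classK_comp => //; apply: dblK; case: bmaxKL => _ bK _; exact: bK.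
Qed.

Let xi_gK : classK (xi \o dbl gmax).
Proof. by apply: classK_comp => //; exact: dblK. Qed.

Let gammaK : classK gamma.
Proof.
apply: classKD; first exact: sigmaK.
exact: (classK_comp xi_gK (dblK classK_id)).
Qed.

Let xi_g_le (s t : R) : 0 <= s -> s <= t + t -> 0 <= t ->
  xi (dbl gmax s) <= gamma t.
Proof.
move=> s0 st t0; rewrite ler_wpDl ?(classK_ge0 sigmaK)//.
exact: (classK_le xi_gK).
Qed.

Let flow_le (t : R) x u : 0 <= t ->
  `|flow T t x u| <= sigma `|x| + xi (dbl gmax `|u|).
Proof.
move=> t0; apply: le_trans (flow_bound (flow_forward_complete x u t0)) _.
by apply: classK_add_le; rewrite ?zero_le_bmax ?(classK_ge0 gmaxK).
Qed.

(* Doubling [q] lets one pass from [`|u| <= q] to all inputs: on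
   [q < `|u| <= 2 q] the asymptotic gain at [2 q] is at most [gamma `|u|]. *)
Lemma flow_uniform_asymptotic_gain (r eps : R) : 0 <= r -> 0 < eps ->
  exists t1 : R, forall (t : R) (x : linfty X) (u : U),
    0 <= t -> t1 <= t -> `|x| <= r -> `|flow T t x u| <= eps + gamma `|u|.
Proof.
move=> r0 eps0; have e2 : 0 < eps / 2 by rewrite divr_gt0.
(* For [|u| <= q] the whole input contribution fits into [eps / 2], which starts the induction. *)
have [q q0 hq] := classK_small xi_gK e2.
have qn0 (n : nat) : 0 <= q * 2 ^+ n by rewrite mulr_ge0 ?exprn_ge0// ltW.
have step (n : nat) : exists t1 : R, forall (t : R) (x : linfty X) (u : U),
    0 <= t -> t1 <= t -> `|x| <= r -> `|u| <= q * 2 ^+ n ->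
    `|flow T t x u| <= eps + gamma `|u|.
  elim: n => [|n [t1 IH]].
    have [t1 ht1] := flow_asymptotic_gain r0 (ltW q0) e2.
    exists t1 => t x u t0 tt1 xr; rewrite expr0 mulr1 => uq.
    apply: le_trans (ht1 t x u t0 tt1 xr uq) _.
    rewrite ler_wpDr ?(classK_ge0 gammaK)//.
    by rewrite [leRHS]splitr lerD2l.
  have [t2 ht2] := flow_asymptotic_gain r0 (qn0 n.+1) eps0.
  exists (Num.max t1 t2) => t x u t0; rewrite ge_max => /andP[tt1 tt2] xr uq.
  have [uqn|/ltW uqn] := leP `|u| (q * 2 ^+ n); first exact: IH.
  apply: le_trans (ht2 t x u t0 tt2 xr uq) _; rewrite lerD2l xi_g_le//.
  by rewrite exprS mulrCA mulr_natl mulr2n lerD.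
(* Finitely many doublings suffice: [r / q < n < 2 ^ n], and once [|u|] exceeds
   [q * 2 ^+ n >= r >= |x|], the bound [flow_le] is already below [gamma |u|] at all times. *)
pose n := Num.bound (r / q).
have rn : r <= q * 2 ^+ n.
  rewrite -ler_pdivrMl// mulrC ltW//.
  apply: lt_le_trans (archi_boundP _) _; first by rewrite divr_ge0// ltW.
  by rewrite -natrX ler_nat ltnW// ltn_expl.
have [t1 ht1] := step n; exists t1 => t x u t0 tt1 xr.
have [uqn|/ltW uqn] := leP `|u| (q * 2 ^+ n); first exact: ht1.
have xu : `|x| <= `|u| := le_trans xr (le_trans rn uqn).
apply: le_trans (flow_le x u t0) _; apply: ler_wpDl (ltW eps0) _.
apply: lerD; first exact: (classK_le sigmaK).
by apply: (classK_le xi_gK) => //; rewrite lerDl.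
Qed.

Lemma small_gain_ISS : ISS T.
Proof.
(* The excess over the input gain, truncated at [0] because the majorant lemma needs a nonnegative
   family. Using [|t|] lets the index run over all real times while only nonnegative ones enter. *)
pose D (e : R * linfty X * U) :=
  Num.max 0 (`|flow T `|e.1.1| e.1.2 e.2| - gamma `|e.2|).
have [b bKL Db] : exists2 b : R -> R -> R, classKL b &
    forall e, D e <= b `|e.1.2| `|e.1.1|.
  apply: (@classKL_majorant _ _ D (fun e => `|e.1.2|) (fun e => `|e.1.1|) sigma
    (0, 0, 0)) => [|e|e|[[t x] u]|r eps r0 eps0] //.
  - by rewrite le_max lexx.
  - rewrite /D/= ge_max (classK_ge0 sigmaK)//= lerBlDr.
    apply: le_trans (flow_le x u (normr_ge0 t)) _.
    by rewrite lerD2l xi_g_le// lerDl.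
  - have [t1 ht1] := flow_uniform_asymptotic_gain r0 eps0.
    exists t1 => -[[t x] u] /= xr tt1; rewrite /D/= ge_max ltW//=.
    by rewrite lerBlDr ht1.
exists b, gamma; split=> //; first by left.
move=> t x u [t0 _]; rewrite -lerBlDr.
have := Db (t, x, u); rewrite /D/= ger0_norm//; apply: le_trans.
by rewrite le_max lexx orbT.
Qed.

End SmallGain.

Theorem theorem6p5 (R : realType) (I : countType) (X : I -> normedModType R)
    (U : input_space R) (S : forall i : I, subsystem X U i)
    (T : control_system (linfty X) U)
    (beta : I -> R -> R -> R) (gain : I -> I -> R -> R) (gainu : I -> R -> R) :
  inhabited I ->
  (forall i, forward_complete (S i)) ->
  is_interconnection S T ->
  (forall i, ISS_summation (S i) (beta i) (gain i) (gainu i)) ->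
  (exists2 beta_max : R -> R -> R, classKL beta_max &
    forall i (r t : R), 0 <= r -> 0 <= t -> beta i r t <= beta_max r t) ->
  (exists2 gain_max : R -> R, classK gain_max &
    forall i (r : R), 0 <= r -> gainu i r <= gain_max r) ->
  (forall r : R, 0 < r ->
    (ereal_sup (range (fun i =>
       \esum_(j in [set: I]) (gain i j r)%:E)) < +oo)%E) ->
  MLIM (@linfty_pos R I) (gain_op gain) ->
  ISS T.
Proof.
move=> _ _ TS S_ISS [bmax bmaxKL beta_le] [gmax gmaxK gainu_le] gain_sup.
move=> [xi [xiK _] mlim].
exact: (small_gain_ISS TS S_ISS bmaxKL gmaxK beta_le gainu_le gain_sup xiK
  mlim).
Qed.
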